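(* Let $k\ge2$ be an integer. If $C$ is a convex body in $\mathbb{R}^n$ for which every $C$-ball convex set is $k$-generated, then $C$ is an $n$-polytope with at most $kn$ facets.
   Context: A convex body is a compact convex set with non-empty interior; an $n$-polytope is an $n$-dimensional convex body that is the convex hull of finitely many points. A set $K\subset\mathbb{R}^n$ is $C$-ball convex if it is $\emptyset$, or $\mathbb{R}^n$, or the intersection of all translates of $C$ that contain $K$. The $C$-ball convex hull of a set $A$ is the intersection of all $C$-ball convex sets that contain $A$. For a fixed $k\ge2$, ''every $C$-ball convex set is $k$-generated'' means that every $C$-ball convex set is the $C$-ball convex hull of at most $k$ points. *)

(* Defs.v *)
From HB Require Import structures.
From mathcomp Require Import all_boot all_order all_algebra.
From mathcomp Require Import all_classical all_reals all_analysis.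

Set Implicit Arguments.
Unset Strict Implicit.
Unset Printing Implicit Defensive.

Import Order.TTheory GRing.Theory Num.Theory.
Import numFieldNormedType.Exports.

Local Open Scope classical_set_scope.
Local Open Scope card_scope.
Local Open Scope ring_scope.

(* R^n is 'rV[R]_n; its library topology (sup norm) is the usual one. *)

Section BallConvexity.
Context {R : realType} {n : nat}.
Implicit Types (C K A P F : set 'rV[R]_n) (k d : nat).

Definition convex_body C :=
  [/\ compact C, @convex_set R 'rV[R]_n C & interior C !=set0].

Definition translate C (x : 'rV[R]_n) : set 'rV[R]_n := [set x + c | c in C].

(* If no translate of C contains K, the intersection below is setT. *)
Definition ball_convex C K :=
  [\/ K = set0, K = setT |
      K = \bigcap_(x in [set x | K `<=` translate C x]) translate C x].

Definition ball_hull C A : set 'rV[R]_n := smallest (ball_convex C) A.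

(* A #<= `I_k: A is finite with at most k elements. *)
Definition generated_by C k K :=
  exists A : set 'rV[R]_n, A #<= `I_k /\ K = ball_hull C A.

Definition convex_hull A : set 'rV[R]_n :=
  smallest (@convex_set R 'rV[R]_n) A.

(* A convex body in R^n is n-dimensional, having non-empty interior. *)
Definition polytope P :=
  convex_body P /\
  exists A : set 'rV[R]_n, finite_set A /\ P = convex_hull A.

(* The affine hull of A is p + V, with \dim V = d; in particular A is
   non-empty. *)
Definition has_affine_dim A d :=
  exists (p : 'rV[R]_n) (V : {vspace 'rV[R]_n}),
    [/\ A p,
        forall x, A x -> x - p \in V,
        forall W : {vspace 'rV[R]_n},
          (forall x, A x -> x - p \in W) -> (V <= W)%VS
      & \dim V = d].

Definition dotv (u x : 'rV[R]_n) : R := \sum_(i < n) u ord0 i * x ord0 i.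

(* Nothing forces u != 0, so P itself is a face, and so is set0. *)
Definition face P F :=
  exists (u : 'rV[R]_n) (h : R),
    (forall x, P x -> dotv u x <= h) /\ F = [set x | P x /\ dotv u x = h].

(* Facets are the faces of dimension n - 1; the form d.+1 = n avoids the
   truncated subtraction (for n = 0 there is no facet). *)
Definition facet P F :=
  face P F /\ exists d : nat, d.+1 = n /\ has_affine_dim F d.

End BallConvexity.

(* Main.v *)
Require Import Defs.
From HB Require Import structures.
From mathcomp Require Import all_boot all_order all_algebra.
From mathcomp Require Import all_classical all_reals all_analysis.
From mathcomp Require Import ring lra.

(* Call a boundary point of C smooth, with unit normal u, when the tangent
   cone of C there is the half-space of the v with u.v < 0. Centres x_i
   close to -p_i, for smooth points p_i with distinct normals u_i, i <= m,
   can be moved so that the points y_i = x_i + p_i are interior to C + x_j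
   for all j <> i. The intersection K of the translates of C containing all
   the y_i is the ball hull of k points a_1, ..., a_k, hence the y_i and
   the a_j lie in the same translates of C. As C + x_i has y_i on its
   boundary, it has some a_j on its boundary too, and smoothness at p_i
   forces u_i.a_j = u_i.y_i. The right-hand sides can be prescribed
   generically in an open subset of R^m, while the left-hand sides depend
   linearly on the kn coordinates of the a_j; so m <= kn and C has at most
   kn smooth normals.

   Every point outside C is cut off by the supporting hyperplane at a
   smooth point, namely at a contact point of an inscribed ball. Hence C is
   a bounded intersection of finitely many half-spaces, that is, a
   polytope, and each facet has a smooth point in its relative interior. *)

Local Open Scope classical_set_scope.
Local Open Scope card_scope.

Section BallConvexGeneration.
Import Order.TTheory GRing.Theory Num.Theory.
Import numFieldNormedType.Exports.
Set Implicit Arguments.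
Unset Strict Implicit.
Unset Printing Implicit Defensive.
Local Open Scope ring_scope.

(** * The Euclidean inner product on row vectors *)

Section Dot.
Context {R : realType} {n : nat}.
Implicit Types (u v x y : 'rV[R]_n).

Lemma dotvC u x : dotv u x = dotv x u.
Proof. by apply: eq_bigr => i _; rewrite mulrC. Qed.

Lemma dotvDr u x y : dotv u (x + y) = dotv u x + dotv u y.
Proof. by rewrite -big_split; apply: eq_bigr => i _; rewrite mxE mulrDr. Qed.

Lemma dotvZr u a x : dotv u (a *: x) = a * dotv u x.
Proof. by rewrite mulr_sumr; apply: eq_bigr => i _; rewrite mxE mulrCA. Qed.

Lemma dotvNr u x : dotv u (- x) = - dotv u x.
Proof. by rewrite -scaleN1r dotvZr mulN1r. Qed.

Lemma dotvBr u x y : dotv u (x - y) = dotv u x - dotv u y.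
Proof. by rewrite dotvDr dotvNr. Qed.

Lemma dotv0r u : dotv u 0 = 0.
Proof. by rewrite -(scale0r (0 : 'rV_n)) dotvZr mul0r. Qed.

Lemma dotvDl u v x : dotv (u + v) x = dotv u x + dotv v x.
Proof. by rewrite dotvC dotvDr !(dotvC x). Qed.

Lemma dotvZl a u x : dotv (a *: u) x = a * dotv u x.
Proof. by rewrite dotvC dotvZr dotvC. Qed.

Lemma dotvNl u x : dotv (- u) x = - dotv u x.
Proof. by rewrite dotvC dotvNr dotvC. Qed.

Lemma dotvBl u v x : dotv (u - v) x = dotv u x - dotv v x.
Proof. by rewrite dotvDl dotvNl. Qed.

Lemma dotvv_ge0 u : 0 <= dotv u u.
Proof. by apply: sumr_ge0 => i _; rewrite -expr2 sqr_ge0. Qed.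

Lemma dotvv_eq0 u : dotv u u = 0 -> u = 0.
Proof.
move=> /eqP; rewrite psumr_eq0; last by move=> i _; rewrite -expr2 sqr_ge0.
move=> /allP uu; apply/rowP => i; rewrite mxE.
by have := uu i (mem_index_enum i); rewrite mulf_eq0 orbb => /eqP.
Qed.

Lemma dotvv_gt0 u : u <> 0 -> 0 < dotv u u.
Proof. by move=> u0; rewrite lt_def dotvv_ge0 andbT; apply/eqP => /dotvv_eq0. Qed.

Lemma dotv_coord_le u i : `|u ord0 i| ^+ 2 <= dotv u u.
Proof.
rewrite /dotv (bigD1 i)//= -expr2 real_normK ?num_real// lerDl.
by apply: sumr_ge0 => j _; rewrite -expr2 sqr_ge0.
Qed.

(** Strict Cauchy-Schwarz, by expanding the positive square of [u - v]. *)
Lemma dotv_unit_lt u v : dotv u u = 1 -> dotv v v = 1 -> u <> v ->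
  dotv u v < 1.
Proof.
move=> uu vv uv; have /dotvv_gt0 : u - v <> 0 by move/subr0_eq.
rewrite dotvBr !dotvBl uu vv (dotvC v u); lra.
Qed.

Lemma dotv_unitZ u : u <> 0 -> exists2 a : R, 0 < a & dotv (a *: u) (a *: u) = 1.
Proof.
move=> /dotvv_gt0 u0; exists (Num.sqrt (dotv u u))^-1.
  by rewrite invr_gt0 sqrtr_gt0.
rewrite dotvZl dotvZr mulrA -expr2 exprVn sqr_sqrtr ?(ltW u0)//.
by rewrite mulVf ?gt_eqF.
Qed.

Lemma continuous_dotv T (F : set_system T) (FF : Filter F) (f g : T -> 'rV[R]_n) x y :
  f @ F --> x -> g @ F --> y -> dotv (f t) (g t) @[t --> F] --> dotv x y.
Proof.
move=> fx gy; apply: cvg_big => [|i _]; [exact: add_continuous|apply: cvgM].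
  exact: (cvg_comp _ _ fx (@coord_continuous _ _ _ ord0 i x)).
exact: (cvg_comp _ _ gy (@coord_continuous _ _ _ ord0 i y)).
Qed.

End Dot.

(** * Convexity with real weights, and points moving along lines *)

Section Convex.
Context {R : realType} {n : nat}.
Implicit Types (u v x y p : 'rV[R]_n) (C A : set 'rV[R]_n).

Lemma convex_setP C : @convex_set R 'rV[R]_n C <->
  forall x y (t : R), 0 <= t <= 1 -> C x -> C y -> C ((1 - t) *: x + t *: y).
Proof.
split=> [cC x y t /andP[t0 t1] Cx Cy|cC].
  have t01 : 0 <= 1 - t <= 1.
    by rewrite subr_ge0 t1 gerBl t0.
  have := cC x y (Itv01 (proj1 (andP t01)) (proj2 (andP t01))).
  rewrite !inE => /(_ Cx Cy).
  by rewrite /conv /= /unstable.onem subKr.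
apply/convex_setW => x y; rewrite !inE => Cx Cy k k0 k1.
rewrite inE /conv/=.
have := cC y x k%:num; rewrite /unstable.onem addrC; apply => //.
by rewrite !ltW.
Qed.

Lemma near_line (A : set 'rV[R]_n) x v (a : R) : open A -> A (x + a *: v) ->
  \forall e \near a, A (x + e *: v).
Proof.
move=> oA Ax; have : x + e *: v @[e --> a] --> x + a *: v.
  by apply: cvgD; [exact: cvg_cst|apply: cvgZr_tmp; exact: cvg_id].
by apply; exact: open_nbhs_nbhs.
Qed.

End Convex.

(** * Interior points of convex sets and smooth boundary points *)

Section Smooth.
Context {R : realType} {n : nat}.
Implicit Types (u v x y p q c : 'rV[R]_n) (C A : set 'rV[R]_n).

Lemma continuous_scale_sub (a : R) y :
  continuous (fun z : 'rV[R]_n => a *: (z - y)).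
Proof.
move=> z; have FF : Filter (nbhs z) by exact: nbhs_filter.
apply: (@cvgZ _ _ _ _ FF); first exact: cvg_cst.
by apply: cvgB; [exact: cvg_id|exact: cvg_cst].
Qed.

(** The homothety with centre [y] and ratio [t] maps [C] into itself and carries a neighbourhood of
    [c] to one of the new point. *)
Lemma interior_segment C c y (t : R) : @convex_set R 'rV[R]_n C ->
  C° c -> C y -> 0 < t <= 1 -> C° ((1 - t) *: y + t *: c).
Proof.
move=> /convex_setP cC Cc Cy /andP[t0 t1].
pose z0 : 'rV[R]_n := (1 - t) *: y + t *: c; rewrite -/z0.
have gz0 : t^-1 *: (z0 - (1 - t) *: y) = c.
  by rewrite /z0 [X in X - _]addrC addrK scalerA mulVf ?scale1r ?gt_eqF.
have : \forall z \near z0, C (t^-1 *: (z - (1 - t) *: y)).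
  by apply: (@continuous_scale_sub _ _ z0 C); rewrite gz0.
apply: filterS => z Cz.
have -> : z = (1 - t) *: y + t *: (t^-1 *: (z - (1 - t) *: y)).
  by rewrite scalerA mulfV ?gt_eqF// scale1r addrC subrK.
by apply: cC; rewrite ?t1 ?(ltW t0).
Qed.

Lemma interior_extend C c q (d : R) : @convex_set R 'rV[R]_n C ->
  C° c -> 0 < d -> C (q + d *: (q - c)) -> C° q.
Proof.
move=> cC Cc d0 Cy.
have d10 : 1 + d != 0 by apply: lt0r_neq0; lra.
have := @interior_segment C c _ (d / (1 + d)) cC Cc Cy.
have -> : (1 - d / (1 + d)) *: (q + d *: (q - c)) + (d / (1 + d)) *: c = q.
  apply/rowP => i; rewrite !mxE; field => //.
apply; rewrite divr_gt0 ?ler_pdivrMr//=; lra.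
Qed.

Lemma normal_interior_lt C u c (h : R) : (forall x, C x -> dotv u x <= h) ->
  u <> 0 -> C° c -> dotv u c < h.
Proof.
move=> uC /dotvv_gt0 u0 Cc.
have Cu : \forall e \near (0 : R), C° (c + e *: u).
  by apply: near_line; [exact: open_interior|rewrite scale0r addr0].
have : \forall e \near (0 : R)^'+, 0 < e /\ C° (c + e *: u).
  by apply: filterI; [exact: nbhs_right_gt|exact: cvg_within].
move=> /filter_ex[e [e0 /interior_subset/uC]].
by rewrite dotvDr dotvZr => /(lt_le_trans _); apply; rewrite ltrDl mulr_gt0.
Qed.

(* The last clause says that the tangent cone of C at p is a half-space. *)
Definition smooth_normal C p u := [/\ C p, forall x, C x -> dotv u x <= dotv u p
  & forall v, dotv u v < 0 -> \forall e \near 0^'+, C° (p + e *: v)].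

Lemma open_dotv_ball c (r : R) : open [set z | dotv (z - c) (z - c) < r].
Proof.
have cd : continuous (fun z : 'rV[R]_n => dotv (z - c) (z - c)).
  move=> z; have FF : Filter (nbhs z) by exact: nbhs_filter.
  by apply: continuous_dotv; apply: cvgB; [exact: cvg_id|exact: cvg_cst
    |exact: cvg_id|exact: cvg_cst].
have := @open_comp _ _ (fun z : 'rV[R]_n => dotv (z - c) (z - c)) [set y | y < r].
by apply; [move=> z _; exact: cd|exact: open_lt].
Qed.

(** A direction [v] with [dotv u v < 0] enters the inner ball, hence the interior of [C]. A point of
    [C] beyond the tangent hyperplane would put the contact point strictly between itself and an
    interior point. *)
Lemma inner_ball_smooth C c u (r : R) : closed C -> @convex_set R 'rV[R]_n C ->
  0 < r -> dotv u u = 1 -> (forall z, dotv (z - c) (z - c) < r ^+ 2 -> C z) ->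
  ~ C° (c + r *: u) -> smooth_normal C (c + r *: u) u.
Proof.
move=> clC cC r0 u1 BC nCp; pose p : 'rV[R]_n := c + r *: u; rewrite -/p.
have CpV v : dotv u v < 0 -> \forall e \near (0 : R)^'+, C° (p + e *: v).
  move=> uv; have ruv : r * dotv u v < 0 by rewrite pmulr_rlt0.
  have v1 : 0 < 1 + dotv v v by rewrite ltr_pwDl ?dotvv_ge0.
  near=> e.
  have e0 : 0 < e by near: e; exact: nbhs_right_gt.
  (* This makes the squared length of [r *: u + e *: v] less than [r ^+ 2]; the summand 1 keeps the
     divisor positive. *)
  have ev : e * (1 + dotv v v) < - (2 * r * dotv u v).
    rewrite -ltr_pdivlMr//; near: e; apply: nbhs_right_lt.
    by rewrite divr_gt0//; lra.
  have oB := @open_dotv_ball c (r ^+ 2).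
  apply: filterS (open_nbhs_nbhs (conj oB _)); first by move=> z /BC.
  rewrite /=.
  rewrite (_ : _ - c = r *: u + e *: v); last by rewrite /p addrAC [c + _]addrC addrK.
  rewrite dotvDr !dotvDl !dotvZl !dotvZr u1 (dotvC v u).
  nra.
have Cp : C p.
  apply: (@closed_cvg _ _ (0 : R)^'+ _ (fun e => p + e *: - u) C clC).
    have : dotv u (- u) < 0 by rewrite dotvNr u1; lra.
    by move=> /CpV; apply: filterS => e /interior_subset.
  rewrite -[X in _ --> X]addr0 -[in X in _ --> X](scale0r (- u)).
  apply: cvgD; [exact: cvg_cst|apply: cvgZr_tmp].
  by apply: cvg_within_filter; exact: cvg_id.
split => // y Cy; rewrite leNgt; apply/negP => py.
have : dotv u (p - y) < 0 by rewrite dotvBr subr_lt0.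
move=> /CpV h; have : \forall e \near (0 : R)^'+, 0 < e /\ C° (p + e *: (p - y)).
  by apply: filterI => //; exact: nbhs_right_gt.
move=> /filter_ex[e [e0 Ce]]; apply: nCp.
(* Prolonging the segment from [p + e *: (p - y)] through [p] by the factor [e^-1] ends exactly at
   [y]. *)
apply: (@interior_extend _ _ _ e^-1 cC Ce); rewrite ?invr_gt0//.
rewrite opprD addrA subrr add0r scalerN scalerA mulVf ?gt_eqF// scale1r.
by rewrite opprB addrC subrK.
Unshelve. all: by end_near. Qed.

End Smooth.

(** * Separating an outside point at a smooth boundary point *)

Section Separation.
Context {R : realType} {n : nat}.
Implicit Types (u v w x y z p q c : 'rV[R]_n) (C A : set 'rV[R]_n).

Lemma interior_dotv_ball C z : C° z ->
  exists2 r : R, 0 < r & forall w, dotv (w - z) (w - z) < r ^+ 2 -> C w.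
Proof.
move=> /nbhs_ballP[r /= r0 rC]; exists r => // w wr; apply: rC; split => // i j.
rewrite (ord1 i) -ball_normE /= distrC.
have := le_lt_trans (dotv_coord_le (w - z) j) wr.
rewrite !mxE ltr_pXn2r// ?nnegrE ?normr_ge0// ltW//.
Qed.

Lemma compact_dotv_ball : compact [set w : 'rV[R]_n | dotv w w <= 1].
Proof.
have cB : compact [set w : 'rV[R]_n | forall i, w ord0 i \in `[-1, 1]].
  by apply: (@rV_compact _ _ (fun=> `[(-1 : R), 1]%classic)) => i; exact: segment_compact.
have cl : closed ((fun w : 'rV[R]_n => dotv w w) @^-1` [set y | y <= 1]).
  apply: closed_comp; last exact: closed_le.
  move=> w _; have FF : Filter (nbhs w) by exact: nbhs_filter.
  by apply: continuous_dotv; exact: cvg_id.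
apply: (subclosed_compact cl cB) => w /= w1 i.
have := le_trans (dotv_coord_le w i) w1.
by rewrite expr_le1// ler_norml in_itv.
Qed.

Lemma continuous_cone z v (e : R) :
  continuous (fun t : R * 'rV[R]_n => z + t.1 *: (v + e *: t.2)).
Proof.
move=> [l w]; have FF : Filter (nbhs (l, w)) by exact: nbhs_filter.
apply: cvgD; first exact: cvg_cst.
apply: (@cvgZ _ _ _ _ FF); first exact: cvg_fst.
apply: cvgD; first exact: cvg_cst.
by apply: (@cvgZ _ _ _ _ FF); [exact: cvg_cst|exact: cvg_snd].
Qed.

(* The balls with centre [z + l (x - z)] and radius [l e] grow with [l]; the
   first one to leave the interior of [C] touches the boundary at a smooth
   point whose normal separates [x] from [C], as [e] is small compared with
   the inradius at [z]. *)
Lemma smooth_separation C x : convex_body C -> ~ C x ->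
  exists p u, [/\ dotv u u = 1, smooth_normal C p u & dotv u p < dotv u x].
Proof.
move=> [/compact_closed clC cC [z Cz]] nCx.
have {}clC := clC (@norm_hausdorff _ _).
have [rho rho0 rhoC] := interior_dotv_ball Cz.
(* The complement of [C] is open, so the segment is outside [C] before reaching [x]; [l0 < 1] makes
   [e] below positive. *)
have [l0 [[l00 l01] nCl0]] : exists l : R, (0 < l /\ l < 1) /\ ~ C (z + l *: (x - z)).
  have h : \forall l \near (1 : R), (~` C) (z + l *: (x - z)).
    apply: near_line; first exact: closed_openC.
    by rewrite scale1r addrC subrK.
  have : \forall l \near (1 : R)^'-, (0 < l /\ l < 1) /\ ~ C (z + l *: (x - z)).
    apply: filterI; last exact: cvg_within.
    by apply: filterI; [exact: nbhs_left_gt|exact: nbhs_left_lt].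
  exact: filter_ex.
pose e := (1 - l0) * rho.
have e0 : 0 < e by rewrite mulr_gt0// subr_gt0.
pose phi (t : R * 'rV[R]_n) : 'rV[R]_n := z + t.1 *: ((x - z) + e *: t.2).
(* Pairs of a stage [l] and a point of its closed ball that is not interior to [C]; compactness
   yields the first such stage. *)
pose T := (`[0, l0]%classic `*` [set w : 'rV[R]_n | dotv w w <= 1]) `&`
   (phi @^-1` (~` C°)).
have cT : compact T.
  apply: compact_closedI.
    by apply: compact_setX; [exact: segment_compact|exact: compact_dotv_ball].
  apply: closed_comp; first by move=> t _; exact: continuous_cone.
  by apply: open_closedC; exact: open_interior.
have T0 : T !=set0.
  exists (l0, 0); split; last first.
    by rewrite /= /phi /= scaler0 addr0 => /interior_subset.
  by split => /=; rewrite ?in_itv/= ?lexx ?(ltW l00)// dotv0r.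
have cf : {within T, continuous (fst : R * 'rV[R]_n -> R)}.
  by apply: continuous_subspaceT => t; exact: cvg_fst.
have [[l w]] := compact_EVT_min T0 cT cf.
rewrite inE /T /= in_itv/= /phi /= => -[[/andP[l_ge0 ll0] w1] nCp] lmin.
have lC l' w' : 0 <= l' -> l' < l -> dotv w' w' <= 1 ->
    C° (z + l' *: ((x - z) + e *: w')).
  move=> l'0 l'l w'1; apply: contrapT => nC'.
  have Tl' : T (l', w').
    by split => //; split => //=; rewrite in_itv/= l'0 (le_trans (ltW l'l)).
  by have := lmin _ (mem_set Tl'); rewrite /= leNgt l'l.
have l_gt0 : 0 < l.
  rewrite lt_def l_ge0 andbT; apply: contra_notN nCp => /eqP ->.
  by rewrite scale0r addr0.
pose r := l * e; pose c : 'rV[R]_n := z + l *: (x - z).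
have r0 : 0 < r by rewrite mulr_gt0.
have pE : z + l *: (x - z + e *: w) = c + r *: w.
  by rewrite /c scalerDr addrA scalerA.
(* By continuity, a point of the open ball at stage [l] already lies in the ball of an earlier
   stage, which is interior to [C]. *)
have BC q : dotv (q - c) (q - c) < r ^+ 2 -> C q.
  move=> qr.
  pose g (l' : R) : 'rV[R]_n := q - (z + l' *: (x - z)).
  have gl : g l' @[l' --> l] --> g l.
    apply: cvgB; first exact: cvg_cst.
    apply: cvgD; first exact: cvg_cst.
    by apply: cvgZr_tmp; exact: cvg_id.
  have hl : dotv (g l') (g l') - (l' * e) ^+ 2 @[l' --> l] -->
      dotv (g l) (g l) - (l * e) ^+ 2.
    apply: cvgB; first exact: continuous_dotv.
    by rewrite expr2; apply: cvgM; apply: cvgM; (exact: cvg_id || exact: cvg_cst).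
  have h : \forall l' \near l, dotv (g l') (g l') - (l' * e) ^+ 2 < 0.
    by apply: (cvgr_lt _ hl); rewrite subr_lt0.
  have : \forall l' \near l^'-, (0 < l' /\ l' < l) /\
      dotv (g l') (g l') - (l' * e) ^+ 2 < 0.
    apply: filterI; last exact: cvg_within.
    by apply: filterI; [exact: nbhs_left_gt|exact: nbhs_left_lt].
  move=> /filter_ex[l' [[l'0 l'l]]]; rewrite subr_lt0 => gl'.
  have le0 : 0 < l' * e by rewrite mulr_gt0.
  have := lC l' ((l' * e)^-1 *: g l') (ltW l'0) l'l.
  rewrite dotvZl dotvZr mulrA -expr2 exprVn mulrC ler_pdivrMr ?exprn_gt0// mul1r.
  rewrite ltW// scalerDr !scalerA mulfV ?gt_eqF// scale1r /g addrA addrC subrK.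
  by move=> /(_ isT)/interior_subset.
rewrite pE in nCp.
have u1 : dotv w w = 1.
  apply/eqP; rewrite eq_le w1 /= leNgt; apply/negP => ww1; apply: nCp.
  have oB := @open_dotv_ball _ _ c (r ^+ 2).
  apply: filterS (open_nbhs_nbhs (conj oB _)); first by move=> y /BC.
  rewrite /= [c + _]addrC addrK dotvZl dotvZr mulrA -expr2 gtr_pMr// exprn_gt0//.
exists (c + r *: w), w; split => //; first exact: inner_ball_smooth.
have [Cp hp _] := inner_ball_smooth clC cC r0 u1 BC nCp.
have : dotv w z + rho <= dotv w (c + r *: w).
  rewrite leNgt; apply/negP => lt_rho.
  have zp := hp _ (interior_subset Cz).
  (* Midway between the distance from [z] to the hyperplane and [rho]: [z + s *: w] is in the ball
     around [z] but beyond the hyperplane. *)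
  pose s := (dotv w (c + r *: w) - dotv w z + rho) / 2.
  have : C (z + s *: w).
    apply: rhoC; rewrite [z + _]addrC addrK dotvZl dotvZr mulrA u1 mulr1 -expr2.
    by rewrite ltr_pXn2r// ?nnegrE ?(ltW rho0)// /s; lra.
  move=> /hp; rewrite dotvDr dotvZr u1 mulr1 /s; lra.
rewrite /c !dotvDr !dotvZr u1 mulr1 dotvBr /r /e.
set a := dotv w x; set b := dotv w z => wz.
have l1 : l < 1 by apply: le_lt_trans l01.
(* With [rho <= l * (a - b) + l * e] and [e <= (1 - l) * rho], this quantity is at least
   [(1 - l) ^+ 2 * rho]. *)
suff : 0 < l * ((1 - l) * (a - b) - l * e) by rewrite pmulr_rgt0// /e; lra.
have -> : l * ((1 - l) * (a - b) - l * e) =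
    (1 - l) * (l * (a - b) + l * e) - l * e by ring.
have : (1 - l) * rho <= (1 - l) * (l * (a - b) + l * e).
  by rewrite ler_pM2l ?subr_gt0// /e; lra.
have : l * e <= l * ((1 - l) * rho).
  by rewrite ler_pM2l// /e ler_pM2r//; lra.
have : 0 < (1 - l) * ((1 - l) * rho) by rewrite !mulr_gt0// subr_gt0.
lra.
Qed.
End Separation.

(** * Bounding the number of smooth normals by generation *)

Section Generation.
Context {R : realType} {n : nat}.
Implicit Types (C A K : set 'rV[R]_n).

Lemma translateP C x z : translate C x z <-> C (z - x).
Proof.
split=> [[c Cc <-]|Cz]; first by rewrite addrC addKr.
by exists (z - x) => //; rewrite addrC subrK.
Qed.

Lemma near_within_line A x v : A° x -> \forall e \near (0 : R)^'+, A (x + e *: v).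
Proof.
move=> Ax; apply: cvg_within.
have : \forall e \near (0 : R), A° (x + e *: v).
  by apply: near_line; [exact: open_interior|rewrite scale0r addr0].
by apply: filterS => e /interior_subset.
Qed.

(* The points of [A] and the [y j] lie in the same translates of [C], and [L]
   is the set of their centres; [y i - p i] is a boundary point of [L]. *)
Lemma generated_active C k m (u p y : 'I_m -> 'rV[R]_n) :
  (forall K, ball_convex C K -> generated_by C k K) ->
  @convex_set R 'rV[R]_n C -> (forall i, dotv (u i) (u i) = 1) ->
  (forall i, smooth_normal C (p i) (u i)) ->
  (forall i j, i != j -> C° (p i + (y j - y i))) ->
  exists a : 'I_k -> 'rV[R]_n, forall i, exists j,
    dotv (u i) (a j) = dotv (u i) (y i).
Proof.
move=> hgen cC u1 smo yint.
pose L := [set x | forall j, C (y j - x)].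
pose K := \bigcap_(x in L) translate C x.
have [|A [/pcard_surjP[g gA] KA]] := hgen K.
  apply: Or33; apply/seteqP; split=> [z Kz x Kx|z Kz x Lx]; first exact: Kx.
  by apply: Kz => w; apply.
have LA x : L x -> forall a, A a -> C (a - x).
  move=> Lx a Aa; apply/translateP.
  have : K a by rewrite KA => B [_ AB]; exact: AB.
  exact.
have AL x : (forall a, A a -> C (a - x)) -> L x.
  move=> Ax j; apply/translateP.
  have : K (y j) by move=> w Lw; apply/translateP.
  rewrite KA; apply; split; last by move=> a /Ax ?; apply/translateP.
  (* A single translate of [C] is ball convex, so it contains the hull as soon as it contains
     [A]. *)
  apply: Or33; apply/seteqP; split=> [z Cz w|z]; first exact.
  by apply.
exists (fun j => g j) => i.
have [Cp up pv] := smo i.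
pose x := y i - p i.
have yx j : y j - x = p i + (y j - y i) by rewrite /x opprB addrCA.
(* Otherwise the centre [x] could move slightly by [- e *: u i] with all of [A] still covered, but
   [y i] would cross the supporting hyperplane. *)
have [a Aa nCa] : exists2 a, A a & ~ C° (a - x).
  apply: contrapT => nA.
  have Ax a : A a -> C° (a - x).
    by move=> Aa; apply: contrapT => nCa; apply: nA; exists a.
  (* The surjection [g] may take values outside [A], hence the guard. *)
  have h : \forall e \near (0 : R)^'+, forall j : 'I_k,
      A (g j) -> C (g j - x + e *: u i).
    apply: filter_forall => j.
    case: (pselect (A (g j))) => [/Ax/near_within_line h|nAg].
      by apply: filterS (h (u i)) => e.
    by near=> e.
  have : \forall e \near (0 : R)^'+, 0 < e /\ forall j : 'I_k,
      A (g j) -> C (g j - x + e *: u i).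
    by apply: filterI => //; exact: nbhs_right_gt.
  move=> /filter_ex[e [e0 he]].
  have : L (x - e *: u i).
    apply: AL => a /[dup] /gA[j jk <-] Aa.
    by rewrite opprB addrA addrAC; exact: (he (Ordinal jk)).
  move=> /(_ i); rewrite opprB addrA addrAC yx subrr addr0 => /up.
  by rewrite dotvDr dotvZr u1 mulr1 gerDl leNgt e0.
have [j jk jE] := gA _ Aa; exists (Ordinal jk); rewrite /= jE.
have Lx : L x.
  move=> l; rewrite yx; have [->|li] := eqVneq l i; first by rewrite subrr addr0.
  by apply: interior_subset; apply: yint; rewrite eq_sym.
pose q := a - x; rewrite -/q in nCa.
have Cq : C q by exact: LA.
suff qp : dotv (u i) q = dotv (u i) (p i).
  by move: qp; rewrite /q /x !dotvBr; lra.
apply/eqP; rewrite eq_le up//= leNgt; apply/negP => qp; apply: nCa.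
(* Choose an interior point [c] of [C], just below [p i], with [dotv (u i) q < dotv (u i) c]. Then
   [q - c] points inward at [p i], so the centre can move by [- e *: (q - c)]. This puts
   [q + e *: (q - c)] in [C] and makes [q] interior. *)
have [tau [tauqp Cc]] : exists tau : R,
    tau < dotv (u i) (p i) - dotv (u i) q /\ C° (p i + tau *: - u i).
  have : \forall tau \near (0 : R)^'+,
    tau < dotv (u i) (p i) - dotv (u i) q /\ C° (p i + tau *: - u i).
    apply: filterI; first by apply: nbhs_right_lt; rewrite subr_gt0.
    by apply: pv; rewrite dotvNr u1 ltrN10.
  exact: filter_ex.
set c := (_ + _) in Cc.
have uqc : dotv (u i) (q - c) < 0.
  by rewrite dotvBr /c dotvDr dotvZr dotvNr u1; lra.
have h : \forall e \near (0 : R)^'+, forall j, C (y j - x + e *: (q - c)).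
  apply: filter_forall => l; rewrite yx; have [->|li] := eqVneq l i.
    rewrite subrr addr0; apply: filterS (pv _ uqc) => e; exact: interior_subset.
  by apply: near_within_line; apply: yint; rewrite eq_sym.
have : \forall e \near (0 : R)^'+, 0 < e /\
    forall j, C (y j - x + e *: (q - c)).
  by apply: filterI => //; exact: nbhs_right_gt.
move=> /filter_ex[e [e0 he]].
have : L (x - e *: (q - c)) by move=> l; rewrite opprB addrA addrAC.
move=> /LA /(_ _ Aa); rewrite opprB addrA addrAC -/q.
exact: interior_extend.
Unshelve. all: by end_near. Qed.

(** These are [m] linear forms in the [k * n] coordinates of [a]; row [i] of [W] holds [u i] in
    block [f i]. *)
Lemma linear_relation k m (u : 'I_m -> 'rV[R]_n) (f : 'I_m -> 'I_k) :
  (k * n < m)%N -> exists2 c : 'rV[R]_m, c != 0 &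
    forall a : 'I_k -> 'rV[R]_n, \sum_i c ord0 i * dotv (u i) (a (f i)) = 0.
Proof.
move=> knm.
pose W : 'M[R]_(m, k * n) := \matrix_i
  mxvec (\matrix_(j, l) ((f i == j)%:R * u i ord0 l) : 'M[R]_(k, n)).
have : kermx W != 0.
  by rewrite -mxrank_eq0 mxrank_ker -lt0n subn_gt0 (leq_ltn_trans _ knm)// rank_leq_col.
move=> /rowV0Pn[c /sub_kermxP cW c0]; exists c => // a.
transitivity (\sum_j \sum_l a j ord0 l *
    (c *m W) ord0 (mxvec_index j l)); last first.
  by rewrite big1 // => j _; rewrite big1 // => l _; rewrite cW mxE mulr0.
transitivity (\sum_i \sum_j \sum_l
    a j ord0 l * (c ord0 i * W i (mxvec_index j l))); last first.
  rewrite exchange_big; apply: eq_bigr => j _; rewrite exchange_big.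
  by apply: eq_bigr => l _; rewrite mxE mulr_sumr.
apply: eq_bigr => i _; rewrite (bigD1 (f i))//= [X in _ + X]big1 ?addr0.
  rewrite /dotv mulr_sumr; apply: eq_bigr => l _.
  by rewrite mxE mxvecE mxE eqxx mul1r; ring.
move=> j /negPf jf; rewrite big1// => l _.
by rewrite mxE mxvecE mxE eq_sym jf mul0r !mulr0.
Qed.

(** The numbers [d / i.+2] with [i < size P] lie strictly between 0 and [d], and are too many to be
    all roots. *)
Lemma nonroot_small (P : {poly R}) (d : R) : P != 0 -> 0 < d ->
  exists x, [/\ 0 < x, x < d & P.[x] != 0].
Proof.
move=> P0 d0; apply: contrapT => nx.
pose s := [seq d / (i.+2)%:R | i <- iota 0 (size P)].
have : (size s < size P)%N.
  apply: max_poly_roots => //.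
    apply/allP => _ /mapP[i _ ->]; apply/negPn/negP => Pi; apply: nx.
    exists (d / i.+2%:R); split => //; first by rewrite divr_gt0 ?ltr0n.
    by rewrite ltr_pdivrMr ?ltr0n// ltr_pMr// ltr1n.
  rewrite map_inj_uniq ?iota_uniq// => i j /(mulfI (lt0r_neq0 d0))/invr_inj/eqP.
  by rewrite eqr_nat => /eqP[].
by rewrite size_map size_iota ltnn.
Qed.

(** With [y i] the multiple of [u i] by a scalar [t i], the active points give
    [dotv (u i) (a (f i)) = t i] for some [f]. Each of the finitely many [f] carries a linear
    relation, which the [t i] are chosen to violate. *)
Lemma smooth_normals_lt C k (u p : 'I_(k * n).+1 -> 'rV[R]_n) :
  (forall K, ball_convex C K -> generated_by C k K) ->
  @convex_set R 'rV[R]_n C -> injective u -> (forall i, dotv (u i) (u i) = 1) ->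
  (forall i, smooth_normal C (p i) (u i)) -> False.
Proof.
move=> hgen cC uI u1 smo.
(* Equal scalars first: [u j - u i] points inward at [p i]. The condition is open, so it survives a
   small perturbation. *)
have [eps epsC] : exists eps : R, forall i j, i != j ->
    C° (p i + eps *: (u j - u i)).
  have : \forall eps \near (0 : R)^'+, forall i j, i != j ->
    C° (p i + eps *: (u j - u i)).
    apply: filter_forall => i; apply: filter_forall => j.
    have [->|ij] := eqVneq i j; first by near=> e.
    have [_ _ pv] := smo i.
    suff /pv h : dotv (u i) (u j - u i) < 0 by apply: filterS h.
    by rewrite dotvBr u1 subr_lt0 dotv_unit_lt// => /uI/eqP; rewrite (negPf ij).
  exact: filter_ex.
(* The numbers [t x i] avoid any given finite set of linear relations for some
   arbitrarily small [x], because the powers of [x] are linearly independent. *)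
pose t (x : R) (i : 'I_(k * n).+1) := eps + x ^+ i.+1.
have hd : \forall x \near (0 : R)^'+, forall i j, i != j ->
    C° (p i + (t x j *: u j - t x i *: u i)).
  apply: filter_forall => i; apply: filter_forall => j.
  have [->|ij] := eqVneq i j; first by near=> e.
  have tc l : t x l @[x --> (0 : R)^'+] --> eps.
    rewrite -[X in _ --> X]addr0 -[X in _ --> _ + X](expr0n R l.+1).
    by apply: cvgD; [exact: cvg_cst|apply: cvg_within_filter; exact: exprn_continuous].
  have h : p i + (t x j *: u j - t x i *: u i) @[x --> (0 : R)^'+] -->
      p i + (eps *: u j - eps *: u i).
    by apply: cvgD; [exact: cvg_cst|apply: cvgB; apply: cvgZr_tmp].
  have : \forall x \near (0 : R)^'+, C° (p i + (t x j *: u j - t x i *: u i)).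
    apply: (h C°); apply: open_nbhs_nbhs; split; first exact: open_interior.
    by rewrite -scalerBr; exact: epsC.
  by apply: filterS => x.
have /nbhs_ballP[d /= d0 dC] := hd.
have /choice[c cP] : forall f : {ffun 'I_(k * n).+1 -> 'I_k},
    exists c : 'rV[R]_(k * n).+1, c != 0 /\ forall a : 'I_k -> 'rV[R]_n,
      \sum_i c ord0 i * dotv (u i) (a (f i)) = 0.
  by move=> f; have [c] := linear_relation u f (ltnSn _); exists c.
pose Q f := \sum_(i < (k * n).+1) c f ord0 i *: (eps%:P + 'X^(i.+1)).
(* The coefficient of degree [i.+1] in [Q f] is the [i]-th entry of [c f]; the product serves all
   [f] with one [x]. *)
have Q0 : \prod_f Q f != 0.
  apply/prodf_neq0 => f _; have [/rV0Pn[i ci] _] := cP f.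
  apply: contraNneq ci => /(congr1 (fun P : {poly R} => P`_i.+1)).
  rewrite coef0 coef_sum (bigD1 i)//= big1 => [|j ji].
    by rewrite coefZ coefD coefC coefXn eqxx add0r mulr1 addr0 => ->.
  rewrite coefZ coefD coefC coefXn eqSS [_ == j :> nat]eq_sym.
  by rewrite (inj_eq val_inj) (negPf ji) addr0 mulr0.
have [x [x0 xd]] := nonroot_small Q0 d0.
rewrite horner_prod => /prodf_neq0 Qx.
have [|a aP] := generated_active (y := fun i => t x i *: u i) hgen cC u1 smo.
  by apply: dC => //; rewrite /ball /= sub0r normrN gtr0_norm.
have /choice[f fP] := aP.
have := Qx (finfun f) isT; rewrite horner_sum => /eqP; apply.
have [_ /(_ a) ca] := cP (finfun f); rewrite -[RHS]ca.
apply: eq_bigr => i _; rewrite ffunE fP dotvZr u1 mulr1.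
by rewrite hornerZ hornerD hornerC hornerXn.
Unshelve. all: by end_near. Qed.

End Generation.

(** * A bounded polyhedron is the convex hull of its vertices *)

Section Polyhedron.
Context {R : realType} {n m : nat} (u : 'I_m -> 'rV[R]_n) (h : 'I_m -> R).

Let P : set 'rV[R]_n := [set x | forall i, dotv (u i) x <= h i].
Let act (x : 'rV[R]_n) : {set 'I_m} := [set i | dotv (u i) x == h i].

Let convexP : @convex_set R 'rV[R]_n P.
Proof.
apply/convex_setP => x y t /andP[t0 t1] Px Py i; rewrite dotvDr !dotvZr.
have := Px i; have := Py i; nra.
Qed.

(** Compactness forces some constraint to increase along [v]; the smallest ratio of slack to speed
    tells which becomes active first. *)
Let ray_exit x v : compact P -> P x -> v <> 0 ->
  (forall i, i \in act x -> dotv (u i) v = 0) ->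
  exists t, [/\ 0 < t, P (x + t *: v) & act x \proper act (x + t *: v)].
Proof.
move=> cP Px v0 actv; have vv := dotvv_gt0 v0.
have [i0 ui0] : exists i, 0 < dotv (u i) v.
  apply: contrapT => nu.
  have P0 : P !=set0 by exists x.
  have cf : {within P, continuous (dotv v)}.
    apply: continuous_subspaceT => w; have FF : Filter (nbhs w) by exact: nbhs_filter.
    by apply: continuous_dotv; [exact: cvg_cst|exact: cvg_id].
  have [c _ cmax] := compact_EVT_max P0 cP cf.
  (* At this [t], [dotv v] exceeds its maximum on [P] by 1. *)
  pose t := (dotv v c - dotv v x + 1) / dotv v v.
  have t0 : 0 <= t.
    by rewrite divr_ge0 ?(ltW vv)// addr_ge0 ?subr_ge0 ?cmax ?inE.
  have : P (x + t *: v).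
    move=> i; rewrite dotvDr dotvZr; apply: le_trans (Px i).
    rewrite gerDl mulr_ge0_le0// leNgt; apply/negP => ui; apply: nu.
    by exists i.
  move=> Pt; have := cmax _ (mem_set Pt).
  by rewrite dotvDr dotvZr /t divfK ?gt_eqF//; lra.
pose ratio i := (h i - dotv (u i) x) / dotv (u i) v.
have [i ui imin] := @arg_minP _ R _ i0 (fun i => 0 < dotv (u i) v) ratio ui0.
have iact : i \notin act x.
  by apply/negP => /actv ui'; move: ui; rewrite ui' ltxx.
have t0 : 0 < ratio i.
  rewrite divr_gt0// subr_gt0 lt_neqAle Px andbT.
  by move: iact; rewrite inE.
exists (ratio i); split => // [j|].
  rewrite dotvDr dotvZr; have [uj|uj] := ltP 0 (dotv (u j) v).
    by rewrite -lerBrDl -ler_pdivlMr// imin.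
  by apply: le_trans (Px j); rewrite gerDl mulr_ge0_le0// ltW.
apply/properP; split.
  apply/fintype.subsetP => j ja; rewrite inE dotvDr dotvZr (actv _ ja) mulr0 addr0.
  by move: ja; rewrite inE.
exists i => //; rewrite inE dotvDr dotvZr /ratio divfK; last by rewrite gt_eqF.
by rewrite addrC subrK.
Qed.

(** At a vertex the active normals span, so the active set determines it and vertices are finitely
    many. Any other point lies between two exit points with more active constraints; induct on the
    number of inactive ones. *)
Lemma polyhedron_convex_hull : compact P ->
  exists A : set 'rV[R]_n, finite_set A /\ P = convex_hull A.
Proof.
move=> cP.
pose V := [set x | P x /\ forall v, (forall i, i \in act x -> dotv (u i) v = 0) ->
  v = 0].
exists V; split.
  apply/finite_set_leP; exists #|{set 'I_m}|; apply/pcard_leP/injfunPex.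
  exists (fun x => nat_of_ord (enum_rank (act x))) => [x _ /=|]; first exact: ltn_ord.
  move=> x y; rewrite !inE => -[_ xV] _ /val_inj/enum_rank_inj axy.
  apply/subr0_eq; apply: xV => i ix; move: (ix); rewrite axy !inE => /eqP iy.
  by move: ix; rewrite inE dotvBr iy => /eqP ->; rewrite subrr.
apply/seteqP; split=> [x Px B [cB VB]|x]; last first.
  by apply; split => // y [].
have [k kx] := ubnP (m - #|act x|); elim: k => // k IH in x kx Px *.
case: (pselect (V x)) => [/VB//|nVx].
have [v [v0 actv]] : exists v, v <> 0 /\ forall i, i \in act x -> dotv (u i) v = 0.
  apply: contrapT => nv; apply: nVx; split => // v vP.
  by apply: contrapT => v0; apply: nv; exists v.
have exit w : w <> 0 -> (forall i, i \in act x -> dotv (u i) w = 0) ->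
    exists t, 0 < t /\ B (x + t *: w).
  move=> w0 actw; have [t [t0 Pt /proper_card xt]] := ray_exit cP Px w0 actw.
  exists t; split => //; apply: IH => //.
  have := max_card (act (x + t *: w)); rewrite card_ord => xm.
  by rewrite -ltnS (leq_trans _ kx)// ltnS ltn_sub2l// (leq_trans xt).
have [t [t0 Bt]] := exit _ v0 actv.
have [s [s0 Bs]] : exists s, 0 < s /\ B (x + s *: - v).
  apply: exit => [/eqP|i /actv]; first by rewrite oppr_eq0 => /eqP.
  by rewrite dotvNr => ->; rewrite oppr0.
have ts0 : t + s != 0 by rewrite gt_eqF// addr_gt0.
have -> : x = (1 - t / (t + s)) *: (x + t *: v) + (t / (t + s)) *: (x + s *: - v).
  by apply/rowP => i; rewrite !mxE; field.
move/convex_setP : cB; apply => //.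
by rewrite divr_ge0 ?ler_pdivrMr ?addr_gt0 ?mul1r ?lerDl// ltW// addr_gt0.
Qed.

End Polyhedron.

(** * Every facet has a smooth point and is determined by its unit normal *)

Section Facets.
Context {R : realType} {n : nat}.
Implicit Types (C F : set 'rV[R]_n).

(** Start from [p] and the zero space. While some [x] in [F] has [x - p] outside [U], add that
    direction and move [q] to the midpoint of [q] and [x]; the dimension bounds the number of
    rounds. *)
Lemma relative_interior F p : @convex_set R 'rV[R]_n F -> F p ->
  exists q (U : {vspace 'rV[R]_n}), [/\ F q, forall x, F x -> x - p \in U &
    forall z, z \in U -> exists e : R, 0 < e /\ F (q + e *: z)].
Proof.
move=> /convex_setP cF Fp.
pose S q z := exists e : R, 0 < e /\ F (q + e *: z).
have shrink q z (e e' : R) : F q -> F (q + e *: z) -> 0 < e -> 0 <= e' <= e ->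
    F (q + e' *: z).
  move=> Fq Fe e0 /andP[e'0 e'e].
  have -> : q + e' *: z = (1 - e' / e) *: q + (e' / e) *: (q + e *: z).
    by apply/rowP => i; rewrite !mxE; field; rewrite gt_eqF.
  by apply: cF; rewrite // divr_ge0 ?ler_pdivrMr ?mul1r// ltW.
have Sadd q z1 z2 : F q -> S q z1 -> S q z2 -> S q (z1 + z2).
  move=> Fq [e1 [e10 F1]] [e2 [e20 F2]].
  have e0 : 0 < Num.min e1 e2 by rewrite lt_min e10.
  exists (Num.min e1 e2 / 2); split; first by rewrite divr_gt0.
  set e := Num.min e1 e2 in e0 *.
  have -> : q + (e / 2) *: (z1 + z2) =
      (1 - 1 / 2) *: (q + e *: z1) + (1 / 2) *: (q + e *: z2).
    by apply/rowP => i; rewrite !mxE; field.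
  by apply: cF; [lra|apply: shrink F1 _ _|apply: shrink F2 _ _];
    rewrite // (ltW e0) /= ge_min lexx ?orbT.
have Sscale q z (a : R) : F q -> 0 <= a -> S q z -> S q (a *: z).
  move=> Fq; rewrite le_eqVlt => /predU1P[<- _|a0 [e [e0 Fe]]].
    by exists 1; rewrite scale0r scaler0 addr0.
  by exists (e / a); rewrite divr_gt0// scalerA divfK ?gt_eqF.
suff IH j q (U : {vspace 'rV[R]_n}) : (\dim {: 'rV[R]_n} - \dim U < j)%N -> F q ->
    q - p \in U -> (forall z, z \in U -> S q z) ->
    exists q (U : {vspace 'rV[R]_n}), [/\ F q, forall x, F x -> x - p \in U &
      forall z, z \in U -> S q z].
  apply: (IH _ p 0%VS (ltnSn _)) => //; first by rewrite subrr mem0v.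
  by move=> z; rewrite memv0 => /eqP ->; exists 1; rewrite scaler0 addr0.
elim: j q U => // j IH q U dU Fq qU US.
case: (pselect (forall x, F x -> x - p \in U)) => [FU|]; first by exists q, U.
move=> /existsNP[x /not_implyP[Fx /negP xU]].
pose q' : 'rV[R]_n := (1 - 1 / 2) *: q + (1 / 2) *: x.
have Fq' : F q' by apply: cF => //; lra.
apply: (IH q' (U + <[x - p]>)%VS) => //.
- rewrite -ltnS; apply: leq_trans dU; rewrite ltnS ltn_sub2l//.
    rewrite ltn_neqAle dimvS ?subvf// andbT; apply: contra xU => /eqP Uf.
    suff /eqP -> : U == fullv by rewrite memvf.
    by rewrite eqEdim subvf Uf leqnn.
  rewrite ltn_neqAle dimvS ?addvSl// andbT; apply: contra xU => /eqP Uf.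
  suff /eqP -> : U == (U + <[x - p]>)%VS.
    by apply: (subvP (addvSr U _)); exact: memv_line.
  by rewrite eqEdim addvSl Uf leqnn.
- have -> : q' - p = (1 - 1 / 2) *: (q - p) + (1 / 2) *: (x - p).
    by apply/rowP => i; rewrite !mxE; field.
  apply: memv_add; first exact: memvZ.
  by apply: memvZ; exact: memv_line.
have US' z : z \in U -> S q' z.
  move=> /US[e [e0 Fe]]; exists (e / 2); split; first by rewrite divr_gt0.
  have -> : q' + (e / 2) *: z = (1 - 1 / 2) *: (q + e *: z) + (1 / 2) *: x.
    by apply/rowP => i; rewrite !mxE; field.
  by apply: cF => //; lra.
move=> _ /memv_addP[z1 z1U [_ /vlineP[a ->] ->]].
(* The first summand is in [U]; along the second, the midpoint [q'] can move both ways, to [x] or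
   back to [q]. *)
have -> : z1 + a *: (x - p) = (z1 + a *: (q - p)) + a *: (x - q).
  by apply/rowP => i; rewrite !mxE; ring.
apply: Sadd => //; first by apply: US'; rewrite memvD ?memvZ.
have [a0|a0] := leP 0 a.
  apply: Sscale => //; exists (1 / 2); split => //.
  by rewrite (_ : q' + _ = x)//; apply/rowP => i; rewrite !mxE; field.
rewrite -[a]opprK scaleNr -scalerN opprB; apply: Sscale => //.
  by rewrite oppr_ge0 ltW.
exists (1 / 2); split => //.
by rewrite (_ : q' + _ = q)//; apply/rowP => i; rewrite !mxE; field.
Qed.

Lemma face_convex C F : @convex_set R 'rV[R]_n C -> face C F ->
  @convex_set R 'rV[R]_n F.
Proof.
move=> /convex_setP cC [w [h [_ ->]]]; apply/convex_setP => x y t t01.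
move=> [Cx xh] [Cy yh]; split; first exact: cC.
by rewrite dotvDr !dotvZr xh yh -mulrDl subrK mul1r.
Qed.

(** At a relative interior point [q] of [F], a vector [v] with [dotv w v < 0] is a positive multiple
    of [c - q], with [c] interior to [C], plus a vector along the facet; so [q + e *: v] is interior
    for small [e]. *)
Lemma facet_smooth_normal C F : convex_body C -> facet C F ->
  exists u, (dotv u u = 1 /\ exists p, smooth_normal C p u) /\
    F = [set x | C x /\ forall y, C y -> dotv u y <= dotv u x].
Proof.
move=> [cC xC [c Cc]] [fF [d [dn [p [V [Fp FV Vmin Vd]]]]]].
have cF := face_convex xC fF.
have [w [h [Ch FE]]] := fF.
have [q [U [Fq FU US]]] := relative_interior cF Fp.
have Cq : C q by move: Fq; rewrite FE => -[].
have qh : dotv w q = h by move: Fq; rewrite FE => -[].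
have ph : dotv w p = h by move: Fp; rewrite FE => -[].
have dimn : \dim {: 'rV[R]_n} = n by rewrite dimvf /dim /= mul1n.
have w0 : w <> 0.
  move=> w0; have FC : C `<=` F.
    by move=> x Cx; rewrite FE; split => //; rewrite -ph w0 !(dotvC 0) !dotv0r.
  suff Vf : V = fullv by move: Vd dn; rewrite Vf dimn => -> /esym/n_Sn.
  apply/vspaceP => v; rewrite memvf.
  have : \forall e \near (0 : R)^'+, 0 < e /\ C (c + e *: v).
    by apply: filterI; [exact: nbhs_right_gt|exact: near_within_line].
  move=> /filter_ex[e [e0 /FC/FV cev]].
  have cp : c - p \in V by apply: FV; apply: FC; exact: interior_subset.
  have : e^-1 *: ((c + e *: v - p) - (c - p)) \in V by rewrite memvZ// memvB.
  rewrite (_ : _ *: _ = v)//.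
  by apply/rowP => i; rewrite !mxE; field; rewrite gt_eqF.
have VU : (V <= U)%VS by exact: Vmin.
have wV z : dotv w z = 0 -> z \in V.
  (* [V] lies in the kernel of [dotv w], a proper subspace as [w] is not in it; the dimension
     [n - 1] forces equality. *)
  pose f : 'rV[R]_n -> R^o := dotv w.
  have lf : linear f by move=> a x y; rewrite /f dotvDr dotvZr.
  pose fL : {linear 'rV[R]_n -> R^o} := HB.pack f (GRing.isLinear.Build _ _ _ _ f lf).
  have kerE x : (x \in lker (linfun fL)) = (dotv w x == 0).
    by rewrite memv_ker lfunE.
  have Vk : (V <= lker (linfun fL))%VS.
    apply: Vmin => x; rewrite FE => -[_ xh].
    by rewrite kerE dotvBr xh ph subrr.
  suff -> : V = lker (linfun fL) by move=> wz; rewrite kerE wz.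
  apply/eqP; rewrite eqEdim Vk Vd -ltnS dn -[X in (_ < X)%N]dimn.
  rewrite ltn_neqAle dimvS ?subvf// andbT; apply/negP => /eqP kf.
  have : w \in lker (linfun fL).
    suff /eqP -> : lker (linfun fL) == fullv by rewrite memvf.
    by rewrite eqEdim subvf kf leqnn.
  by rewrite kerE => /eqP /dotvv_eq0.
have wc : dotv w c < h by exact: normal_interior_lt Ch w0 Cc.
have [a a0 aw1] := dotv_unitZ w0.
exists (a *: w); split; last first.
  rewrite FE; apply/seteqP; split=> x [Cx xh]; split => //.
    by move=> y Cy; rewrite !dotvZl ler_pM2l// xh; exact: Ch.
  apply/eqP; rewrite eq_le Ch//= -qh.
  by have := xh _ Cq; rewrite !dotvZl ler_pM2l.
split => //; exists q; split => // [x Cx|v].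
  by rewrite !dotvZl ler_pM2l// qh; exact: Ch.
rewrite dotvZl pmulr_rlt0// => wv.
pose al := dotv w v / dotv w (c - q).
have wcq : dotv w (c - q) < 0 by rewrite dotvBr qh subr_lt0.
have al0 : 0 < al by rewrite nmulr_rgt0// invr_lt0.
have al2 : 0 < 2 * al by rewrite pmulr_rgt0.
pose z := v - al *: (c - q).
have [e0 [e00 Fe0]] : exists e, 0 < e /\ F (q + e *: z).
  apply: US; apply: (subvP VU); apply: wV.
  by rewrite /z dotvBr dotvZr /al divfK ?lt_eqF// subrr.
near=> e.
have e_gt0 : 0 < e by near: e; exact: nbhs_right_gt.
have ee0 : e < e0 / 2 by near: e; apply: nbhs_right_lt; rewrite divr_gt0.
have eal : e < (2 * al)^-1.
  by near: e; apply: nbhs_right_lt; rewrite invr_gt0.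
have eal1 : 2 * e * al <= 1.
  by rewrite mulrAC [2 * al * e]mulrC -ler_pdivlMr// mul1r ltW.
have Cqe : C° ((1 - 2 * e * al) *: q + (2 * e * al) *: c).
  by apply: interior_segment => //; rewrite eal1 mulrAC mulr_gt0.
have Cz : C (q + (2 * e) *: z).
  have -> : q + (2 * e) *: z =
      (1 - 2 * e / e0) *: q + (2 * e / e0) *: (q + e0 *: z).
    by apply/rowP => i; rewrite !mxE; field; rewrite gt_eqF.
  move/convex_setP : xC; apply => //; last by move: Fe0; rewrite FE => -[].
  by rewrite divr_ge0 ?ler_pdivrMr ?mul1r//; [lra|lra|exact: ltW].
(* The steps were doubled so that [q + e *: v] is the midpoint of an interior point and a point of
   [C]. *)
have := @interior_segment _ _ _ _ _ (1 / 2) xC Cqe Cz.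
rewrite (_ : (1 - 1 / 2) *: _ + _ = q + e *: v); last first.
  by apply/rowP => i; rewrite /z !mxE; field.
by apply; lra.
Unshelve. all: by end_near. Qed.

End Facets.

(** * Extracting distinct elements from a failed cardinality bound *)

Lemma card_gt_injection (T : choiceType) (A : set T) m : ~ (A #<= `I_m) ->
  exists f : 'I_m.+1 -> T, injective f /\ forall i, A (f i).
Proof.
move=> nA.
have : `I_m.+1 #<= A.
  case: (pselect (finite_set A)) => [[q Aq]|/infiniteP/(card_le_trans _)]; last first.
    by apply; exact: card_leT.
  rewrite (card_le_eqr Aq) card_le_II ltnNge; apply/negP => qm; apply: nA.
  by rewrite (card_le_eql Aq) card_le_II.
have [x Ax] : A !=set0.
  by apply/set0P/negP => /eqP A0; apply: nA; rewrite A0; exact: card_ge0.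
pose T' : pointedType := HB.pack T (isPointed.Build T x).
move=> /(@pcard_leP _ T')/injfunPex[f fA fI].
exists (fun i => f i); split=> [i j ij|i]; last by apply: fA => /=.
by apply/val_inj/fI; rewrite ?inE //=.
Qed.

End BallConvexGeneration.

Theorem theorem9 (R : realType) (n k : nat) (hk : (2 <= k)%N)
    (C : set 'rV[R]_n) (hC : convex_body C)
    (hgen : forall K : set 'rV[R]_n, ball_convex C K -> generated_by C k K) :
  polytope C /\ [set F : set 'rV[R]_n | facet C F] #<= `I_(k * n).
Proof.
have [cC xC _] := hC.
pose N := [set u : 'rV[R]_n | dotv u u = 1%R /\ exists p, smooth_normal C p u].
have cardN : N #<= `I_(k * n).
  apply: contrapT => /card_gt_injection[u [uI uN]].
  have /choice[p pP] : forall i, exists p, smooth_normal C p (u i).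
    by move=> i; have [] := uN i.
  apply: (smooth_normals_lt hgen xC uI _ pP) => i.
  by have [] := uN i.
split; last first.
  (* Every facet is the set where its unit normal is maximal on [C], so the facets lie in the image
     of [N]. *)
  pose exposed (u : 'rV[R]_n) :=
    [set x | C x /\ forall y, C y -> (dotv u y <= dotv u x)%R].
  apply: card_le_trans cardN; apply: card_le_trans (card_image_le exposed N).
  apply: subset_card_le => F /(facet_smooth_normal hC)[u [uN ->]].
  by exists u.
split => //.
have /finite_seqP[s Ns] : finite_set N by apply/finite_set_leP; exists (k * n)%N.
pose u (i : 'I_(size s)) := nth 0%R s i.
have uN i : N (u i) by rewrite Ns /=; exact: mem_nth.
have /choice[p pP] : forall i, exists p, smooth_normal C p (u i).
  by move=> i; have [] := uN i.
have CE : C = [set x | forall i, (dotv (u i) x <= dotv (u i) (p i))%R].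
  apply/seteqP; split=> x; first by move=> Cx i; have [_ + _] := pP i; apply.
  move=> xP; apply: contrapT => /(smooth_separation hC)[q [v [v1 vq qx]]].
  have : N v by split => //; exists q.
  rewrite Ns /= => /(nthP 0%R)[i si iv].
  have := xP (Ordinal si); have [Cp _ _] := pP (Ordinal si).
  have [_ /(_ _ Cp) h _] := vq; rewrite /u /= iv => /Order.POrderTheory.le_trans/(_ h).
  by rewrite Order.TotalTheory.leNgt qx.
by rewrite {2}CE in cC *; apply: polyhedron_convex_hull; rewrite -CE.
Qed.
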